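(* Let $N\ge 1$ and let $\{(X_t,Y_t)\}_{t\ge0}$ be the continuous-time Maki--Thompson (MT) rumor process on the state space $S'=\{(x,y)\in\mathbb{Z}^2: 0\le x\le N,\ 0\le y\le N+1-x\}$, with transient set $S=S'\setminus\Delta$ and absorbing set $\Delta=\{(x,0): 0\le x\le N-1\}$, and absorption time $\tau_\Delta=\inf\{t>0: Y_t=0\}$. Then the process has a unique quasi-stationary distribution on $S$, namely $\nu=\delta_{(0,1)}$, the point mass at $(0,1)$. Moreover, for every probability distribution $\mu$ on $S$, $$\lim_{t\to\infty} P_\mu(X_t=x,\,Y_t=y \mid \tau_\Delta>t)=\nu(x,y)\quad\text{for all }(x,y)\in S,$$ i.e. $\delta_{(0,1)}$ is the Yaglom limit (quasi-limiting distribution) for every initial distribution on $S$.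
   Context: MT model: population of size $N+1$; $X_t$, $Y_t$ are the numbers of ignorants and spreaders at time $t$ (stiflers $Z_t=N+1-X_t-Y_t$). It is the continuous-time Markov chain on $S'$ whose only transitions from a state $(X,Y)$ are $(X,Y)\to(X-1,Y+1)$ at rate $XY$ and $(X,Y)\to(X,Y-1)$ at rate $Y(N-X)$ (so the total rate out of $(X,Y)$ is $NY$). For a probability measure $\nu$ on $S$, $P_\nu$ denotes the law of the chain started with initial distribution $\nu$. A probability measure $\nu$ on $S$ is a quasi-stationary distribution (QSD) if $P_\nu(X_t\in A\mid \tau_\Delta>t)=\nu(A)$ for all $t\ge0$ and all $A\subset S$ (here $X_t$ stands for the state $(X_t,Y_t)$).
   Formalization: The transient set is taken as S={(x,y) in S': y≥1}, excluding (N,0), which S'\Δ literally contains; from (N,0) one has Y≡0, so conditioning on τ_Δ>t is undefined for the point mass there and the claim as written has no meaning. *)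

(* Defs.v *)
From HB Require Import structures.
From mathcomp Require Import all_boot all_order all_algebra.
From mathcomp Require Import all_classical all_reals all_analysis.
Set Implicit Arguments. Unset Strict Implicit. Unset Printing Implicit Defensive.
Import Order.TTheory GRing.Theory Num.Theory numFieldNormedType.Exports.
Local Open Scope ring_scope.

Definition state (N : nat) : finType := ('I_N.+1 * 'I_N.+2)%type.

Definition sx N (s : state N) : nat := nat_of_ord s.1.
Definition sy N (s : state N) : nat := nat_of_ord s.2.

Definition inSp N (s : state N) : bool := (sx s + sy s <= N.+1)%N.
Definition inDelta N (s : state N) : bool := inSp s && (sy s == 0%N).
Definition inS N (s : state N) : bool := inSp s && (0 < sy s)%N.

(* Generator (Q-matrix) of the MT chain on S'. Off-diagonal rates:
   (x,y) -> (x-1,y+1) at rate x*y, (x,y) -> (x,y-1) at rate y*(N-x);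
   diagonal entry = - total rate = - N*y. States outside S' get rate 0. *)
Definition Qrate (R : realType) N (s s' : state N) : R :=
  if ~~ inSp s then 0 else
  if s == s' then - ((N * sy s)%:R)
  else if (sx s' + 1 == sx s)%N && (sy s' == sy s + 1)%N then ((sx s * sy s)%:R)
  else if (sx s' == sx s) && (sy s' + 1 == sy s)%N then ((sy s * (N - sx s))%:R)
  else 0.

Fixpoint Qpow (R : realType) N (k : nat) (s s' : state N) : R :=
  match k with
  | 0%N => (s == s')%:R
  | k.+1 => \sum_(u : state N) Qrate R s u * Qpow R k u s'
  end.

Definition Ptrans (R : realType) N (t : R) (s s' : state N) : R :=
  limn (series (fun k => t ^+ k / (k`!)%:R * Qpow R k s s')).

Definition probOnS (R : realType) N (mu : state N -> R) : Prop :=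
  (forall s, 0 <= mu s) /\ (forall s, ~~ inS s -> mu s = 0) /\
  \sum_(s : state N) mu s = 1.

Definition lawAt (R : realType) N (mu : state N -> R) (t : R) (z : state N) : R :=
  \sum_(s : state N) mu s * Ptrans t s z.

(* P_mu(tau_Delta > t) = P_mu(X_t in S), since Delta is absorbing *)
Definition survProb (R : realType) N (mu : state N -> R) (t : R) : R :=
  \sum_(z : state N | inS z) lawAt mu t z.

Definition condLaw (R : realType) N (mu : state N -> R) (t : R) (A : {set state N}) : R :=
  (\sum_(z in A) lawAt mu t z) / survProb mu t.

Definition isQSD (R : realType) N (nu : state N -> R) : Prop :=
  probOnS nu /\
  forall (t : R), 0 <= t -> forall A : {set state N}, A \subset [set z | inS z] ->
    condLaw nu t A = \sum_(z in A) nu z.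

Definition st01 N : state N := (ord0, inord 1).
Definition delta01 (R : realType) N (z : state N) : R := (z == st01 N)%:R.

(* Main.v *)
(** Write [u_z(t) = e^(N t) P_mu((X_t, Y_t) = z)]. By the forward equation
[u_(x,y)' = - N (y - 1) u_(x,y) + inflow], where the inflow comes only from
[(x + 1, y - 1)] and [(x, y + 1)]; hence bounds propagate along decreasing
[2 x + y] by comparison of scalar linear differential inequalities. All states
[(x, 1)] share the top eigenvalue [- N], so if [m] is the largest number of
ignorants charged by [mu], the mass of [(x, 1)] grows like [t^(m - x)], and that
of [(x, y)] with [y >= 2] strictly slower. We use the crude but uniform upper
bound [u_(x,y) = O((1 + t)^(m - x + [y = 1] - 1/2))]: the exponents lose one half,
so that they survive both integration and exponential damping, also for
[x = m]. From below, the weights [y r^(y-1)] with [r = (N - x) / N] give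
row masses [V_x] with [V_x' >= V_(x+1) / N], hence a survival probability of
order at least [t^m e^(-N t)]. Every state of [S] other than [(0, 1)] is thus
negligible after conditioning, which gives the Yaglom limit; a quasi-stationary
distribution is its own Yaglom limit, whence uniqueness. *)

Require Import Defs.
From HB Require Import structures.
From mathcomp Require Import all_boot all_order all_algebra.
From mathcomp Require Import all_classical all_reals all_analysis.
From mathcomp Require Import ring lra zify.
Import Order.TTheory GRing.Theory Num.Theory numFieldNormedType.Exports.
Local Open Scope classical_set_scope.
Local Open Scope ring_scope.

Lemma ODE_comparison {R : realType} (a : R) (u w du dw : R -> R) :
  (forall t : R, 0 <= t -> is_derive t 1 u (du t)) ->
  (forall t : R, 0 <= t -> is_derive t 1 w (dw t)) ->
  u 0 <= w 0 ->
  (forall t : R, 0 <= t -> du t + a * u t <= dw t + a * w t) ->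
  forall t : R, 0 <= t -> u t <= w t.
Proof.
move=> hu hw h0 hd.
pose g (t : R) : R := expR (a * t) * (w t - u t).
pose dg (t : R) : R := expR (a * t) * ((dw t + a * w t) - (du t + a * u t)).
have hg (t : R) : 0 <= t -> is_derive t 1 g (dg t).
  move=> t0; have hut := hu t t0; have hwt := hw t t0.
  rewrite /g; apply: is_derive_eq.
  rewrite /dg /GRing.scale /=. ring.
have mono : forall x y : R, 0 <= x -> x <= y -> g x <= g y.
  apply: ger0_derive1_ndecry.
  - by move=> x; rewrite in_itv/= andbT => /ltW/hg; apply: @ex_derive.
  - move=> x; rewrite in_itv/= andbT => /ltW x0.
    have hgx := hg _ x0; rewrite derive1E derive_val.
    by rewrite mulr_ge0 ?expR_ge0// subr_ge0 hd.
  - apply: derivable_within_continuous => x; rewrite in_itv/= andbT => /hg.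
    by apply: @ex_derive.
move=> t t0; have := mono 0 t (lexx _) t0.
rewrite /g mulr0 expR0 mul1r => h.
have : 0 <= expR (a * t) * (w t - u t).
  by apply: le_trans h; rewrite subr_ge0.
by rewrite pmulr_rge0 ?expR_gt0// subr_ge0.
Qed.

Lemma is_derive_sum_fin {R : realType} {I : finType} (h : I -> R -> R) (dh : I -> R)
    (t : R) :
  (forall i, is_derive t 1 (h i) (dh i)) ->
  is_derive t 1 (fun x => \sum_i h i x) (\sum_i dh i).
Proof.
move=> H.
have -> : (fun x => \sum_i h i x) = \sum_i h i.
  by apply/funext => x; rewrite fct_sumE.
by elim/big_ind2 : _ => // [|] *; [exact: is_derive_cst|exact: is_deriveD].
Qed.

Lemma QpowSr (R : realType) (N : nat) k (s z : state N) :
  Qpow R k.+1 s z = \sum_(u : state N) Qpow R k s u * Qrate R u z.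
Proof.
elim: k s z => [|k IH] s z.
  rewrite /= (bigD1 z)//= eqxx mulr1 big1 ?addr0; last first.
    by move=> i /negPf ->; rewrite mulr0.
  rewrite (bigD1 s)//= eqxx mul1r big1 ?addr0//.
  by move=> i; rewrite eq_sym => /negPf ->; rewrite mul0r.
rewrite [LHS]/=; under eq_bigr => u _ do rewrite -/(Qpow R k.+1 u z) IH mulr_sumr.
rewrite exchange_big /=; apply: eq_bigr => v _.
by rewrite mulr_suml; apply: eq_bigr => u _; rewrite mulrA.
Qed.

Lemma Qpow_bound (R : realType) (N : nat) :
  exists2 A : R, 0 <= A & forall k (s z : state N), `|Qpow R k s z| <= A ^+ k.
Proof.
pose A : R := \sum_(s : state N) \sum_(u : state N) `|Qrate R s u|.
have A0 : 0 <= A by apply: sumr_ge0 => s _; apply: sumr_ge0.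
exists A => // k; elim: k => [|k IH] s z.
  by rewrite /= expr0; case: eqP; rewrite ?normr1 ?normr0.
rewrite /=; apply: (le_trans (ler_norm_sum _ _ _)).
apply: (@le_trans _ _ (\sum_u `|Qrate R s u| * A ^+ k)).
  by apply: ler_sum => u _; rewrite normrM ler_wpM2l.
rewrite -mulr_suml exprS ler_wpM2r ?exprn_ge0//.
by rewrite /A [leRHS](bigD1 s)//= lerDl; apply: sumr_ge0 => v _; apply: sumr_ge0.
Qed.

Lemma is_cvg_pseries_geometric_fact {R : realType} (A : R) (c : R^nat) (x : R) :
  0 <= A -> (forall k, `|c k| <= A ^+ k) -> cvgn (pseries (fun k => c k / k`!%:R) x).
Proof.
move=> A0 hc; apply: normed_cvg.
apply: (@series_le_cvg _ _ (exp_coeff (A * `|x|))) => //=.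
- by move=> n; rewrite /exp_coeff /= divr_ge0// exprn_ge0// mulr_ge0.
- move=> n; rewrite !normrM normfV normrX [`|n`!%:R|]ger0_norm// /exp_coeff /=.
  by rewrite exprMn mulrAC ler_wpM2r ?invr_ge0// ler_wpM2r ?exprn_ge0.
- exact: is_cvg_series_exp_coeff.
Qed.

Lemma PtransE (R : realType) (N : nat) (t : R) (s z : state N) :
  Ptrans t s z = limn (pseries (fun k => Qpow R k s z / k`!%:R) t).
Proof.
rewrite /Ptrans /pseries; congr (limn (series _)); apply/funext => k /=.
by rewrite mulrC mulrA mulrAC.
Qed.

Lemma is_cvg_Ptrans (R : realType) (N : nat) (t : R) (s z : state N) :
  cvgn (pseries (fun k => Qpow R k s z / k`!%:R) t).
Proof.
have [A A0 hA] := Qpow_bound R N.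
exact: is_cvg_pseries_geometric_fact A _ t A0 (fun k => hA k s z).
Qed.

Lemma pseries_diffs_fact {R : realType} (c : R^nat) :
  pseries_diffs (fun k => c k / k`!%:R) = fun k => c k.+1 / k`!%:R.
Proof.
apply/funext => k; rewrite /pseries_diffs factS natrM invfM.
by rewrite mulrCA [k.+1%:R * _]mulrA divff ?mul1r// pnatr_eq0.
Qed.

Lemma is_derive_Ptrans (R : realType) (N : nat) (t : R) (s z : state N) :
  is_derive t 1 (fun t => Ptrans t s z)
    (\sum_(u : state N) Ptrans t s u * Qrate R u z).
Proof.
have [A A0 hA] := Qpow_bound R N.
have -> : (fun t => Ptrans t s z) =
    fun t => limn (pseries (fun k => Qpow R k s z / k`!%:R) t).
  by apply/funext => x; rewrite PtransE.
have shift j (x : R) : cvgn (pseries (fun k => Qpow R (k + j) s z / k`!%:R) x).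
  pose c k := (Qpow R (k + j) s z) / (1 + A) ^+ j.
  have A1 : 0 < 1 + A by rewrite ltr_pwDl.
  have B0 : (1 + A) ^+ j != 0 by rewrite gt_eqF// exprn_gt0.
  have -> : pseries (fun k => Qpow R (k + j) s z / k`!%:R) x =
     (fun n => (1 + A) ^+ j * pseries (fun k => c k / k`!%:R) x n).
    apply/funext => n; rewrite /pseries /series /= mulr_sumr.
    apply: eq_bigr => k _; rewrite /c.
    rewrite -[in LHS](mulfVK B0 (Qpow R (k + j) s z)); ring.
  apply: is_cvgM; first exact: is_cvg_cst.
  apply: (is_cvg_pseries_geometric_fact (1 + A)) => [|k]; first exact: ltW.
  rewrite /c normrM normfV [`|(1 + A) ^+ j|]ger0_norm ?exprn_ge0 ?(ltW A1)//.
  rewrite ler_pdivrMr ?exprn_gt0// -exprD; apply: (le_trans (hA _ _ _)).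
  by apply: lerXn2r; rewrite ?nnegrE ?(ltW A1)// lerDr.
have E1 : pseries_diffs (fun k => Qpow R k s z / k`!%:R) =
    fun k => Qpow R (k + 1) s z / k`!%:R.
  by rewrite pseries_diffs_fact; apply/funext => k; rewrite addn1.
have E2 : pseries_diffs (fun k => Qpow R (k + 1) s z / k`!%:R) =
    fun k => Qpow R (k + 2) s z / k`!%:R.
  by rewrite pseries_diffs_fact; apply/funext => k; rewrite addn1 addn2.
have D : is_derive t 1 (fun t => limn (pseries (fun k => Qpow R k s z / k`!%:R) t))
    (limn (pseries (fun k => Qpow R (k + 1) s z / k`!%:R) t)).
  rewrite -E1; apply: (@pseries_snd_diffs _ _ (`|t| + 1)).
  - exact: is_cvg_Ptrans.
  - by rewrite E1; exact: shift.
  - by rewrite E1 E2; exact: shift.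
  - by rewrite [ltRHS]ger0_norm ?addr_ge0// ltrDl.
apply: (is_derive_eq D).
apply/cvg_lim => //.
have -> : pseries (fun k => Qpow R (k + 1) s z / k`!%:R) t =
   (fun n => \sum_(u : state N)
       pseries (fun k => Qpow R k s u / k`!%:R) t n * Qrate R u z).
  apply/funext => n; rewrite /pseries /series /=.
  under [RHS]eq_bigr do rewrite mulr_suml.
  rewrite exchange_big /=; apply: eq_bigr => k _.
  rewrite addn1 QpowSr !mulr_suml; apply: eq_bigr => u _.
  ring.
apply: cvg_big => [|u _]; first exact: add_continuous.
apply: cvgMr_tmp; rewrite PtransE.
exact: is_cvg_Ptrans.
Qed.

Lemma Ptrans0 (R : realType) (N : nat) (s z : state N) :
  Ptrans (0 : R) s z = (s == z)%:R.
Proof.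
apply/cvg_lim => //; rewrite -cvg_shiftS.
apply: (@cvg_trans _ ((fun=> (s == z)%:R : R) @ \oo)); last exact: cvg_cst.
apply: near_eq_cvg; near=> n => /=.
rewrite /series /= big_nat_recl// expr0 fact0 invr1 !mul1r big1 ?addr0// => i _.
by rewrite exprS !mul0r.
Unshelve. all: by end_near. Qed.

Definition scaledLaw {R : realType} {N : nat} (mu : state N -> R) (t : R)
  (z : state N) : R := expR (N%:R * t) * lawAt mu t z.

Lemma scaledLaw0 (R : realType) (N : nat) (mu : state N -> R) (z : state N) :
  scaledLaw mu 0 z = mu z.
Proof.
rewrite /scaledLaw mulr0 expR0 mul1r /lawAt (bigD1 z)//= Ptrans0 eqxx mulr1.
by rewrite big1 ?addr0// => s /negPf sz; rewrite Ptrans0 sz mulr0.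
Qed.

Lemma is_derive_scaledLaw (R : realType) (N : nat) (mu : state N -> R) (z : state N)
    (t : R) :
  is_derive t 1 (fun t => scaledLaw mu t z)
    (N%:R * scaledLaw mu t z + \sum_(u : state N) scaledLaw mu t u * Qrate R u z).
Proof.
have D : is_derive t 1 (fun t => lawAt mu t z)
    (\sum_(u : state N) lawAt mu t u * Qrate R u z).
  have -> : \sum_(u : state N) lawAt mu t u * Qrate R u z =
      \sum_(s : state N) mu s * (\sum_(u : state N) Ptrans t s u * Qrate R u z).
    under eq_bigr do rewrite mulr_suml.
    rewrite exchange_big /=; apply: eq_bigr => s _; rewrite mulr_sumr.
    by apply: eq_bigr => u _; rewrite mulrA.
  apply: is_derive_sum_fin => s.
  have Ds := is_derive_Ptrans R N t s z.
  by apply: is_derive_eq; rewrite /GRing.scale /=; ring.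
rewrite /scaledLaw; apply: is_derive_eq.
under [in RHS]eq_bigr do rewrite -mulrA.
by rewrite -mulr_sumr /GRing.scale /=; ring.
Qed.

Lemma Qrate_ge0 (R : realType) (N : nat) (u z : state N) :
  u != z -> 0 <= Qrate R u z.
Proof. by rewrite /Qrate => /negPf ->; do 3?case: ifP. Qed.

Lemma Qrate_neq0 (R : realType) (N : nat) (u z : state N) :
  u != z -> Qrate R u z != 0 ->
  inS u /\ (sx u = (sx z + 1)%N /\ sy z = (sy u + 1)%N \/
            sx u = sx z /\ sy u = (sy z + 1)%N).
Proof.
rewrite /Qrate /inS => /negPf ->; case: (inSp u) => /=; last by rewrite eqxx.
case: ifP => [/andP[/eqP <- /eqP ->]|_].
  by rewrite pnatr_eq0 muln_eq0 negb_or lt0n => /andP[_ ->]; split=> //; left.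
case: ifP => [/andP[/eqP <- /eqP <-]|_]; last by rewrite eqxx.
by rewrite addn1; split=> //; right.
Qed.

(* The quantity 2x+y drops by exactly one along every transition. *)
Lemma inS_predecessor_ind (R : realType) (N : nat) (P : state N -> Prop) :
  (forall z, inS z ->
     (forall u, inS u -> u != z -> Qrate R u z != 0 -> P u) -> P z) ->
  forall z, inS z -> P z.
Proof.
move=> H z; have [n] := ubnP (3 * N + 3 - (2 * sx z + sy z)).
elim: n z => // n IH z hn zS; apply: H => // u uS uz Quz.
apply: IH => //; have [_ h] := Qrate_neq0 R N u z uz Quz.
have := ltn_ord u.1; have := ltn_ord u.2.
rewrite -/(sx u) -/(sy u) => h1 h2; lia.
Qed.

Definition inflow {R : realType} {N : nat} (mu : state N -> R) (t : R)
  (z : state N) : R := \sum_(u : state N | u != z) scaledLaw mu t u * Qrate R u z.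

Lemma is_derive_scaledLaw_inflow (R : realType) (N : nat) (mu : state N -> R)
    (z : state N) (t : R) : inS z ->
  is_derive t 1 (fun t => scaledLaw mu t z)
    (inflow mu t z - (N * (sy z).-1)%:R * scaledLaw mu t z).
Proof.
case/andP => zSp y0; apply: (is_derive_eq (is_derive_scaledLaw R N mu z t)).
rewrite (bigD1 z)//= -/(inflow mu t z).
rewrite /Qrate zSp eqxx /=.
by case: (sy z) y0 => // y _ /=; rewrite mulnS natrD; ring.
Qed.

Lemma scaledLaw_le (R : realType) (N : nat) (mu : state N -> R) (z : state N)
    (w dw : R -> R) : inS z ->
  (forall t : R, 0 <= t -> is_derive t 1 w (dw t)) ->
  mu z <= w 0 ->
  (forall t : R, 0 <= t -> inflow mu t z <= dw t + (N * (sy z).-1)%:R * w t) ->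
  forall t : R, 0 <= t -> scaledLaw mu t z <= w t.
Proof.
move=> zS hw h0 hd.
apply: (ODE_comparison (N * (sy z).-1)%:R _ _ _ _ _ hw).
- by move=> t _; apply: is_derive_scaledLaw_inflow.
- by rewrite scaledLaw0.
- by move=> t t0; rewrite subrK; apply: hd.
Qed.

Lemma scaledLaw_ge0 (R : realType) (N : nat) (mu : state N -> R) :
  (forall s, 0 <= mu s) ->
  forall z, inS z -> forall t : R, 0 <= t -> 0 <= scaledLaw mu t z.
Proof.
move=> mu0; apply: (inS_predecessor_ind R) => z zS IH.
apply: (ODE_comparison (N * (sy z).-1)%:R (cst 0) (fun t => scaledLaw mu t z)
  (cst 0) (fun t => inflow mu t z - (N * (sy z).-1)%:R * scaledLaw mu t z)).
- by move=> t _; apply: is_derive_scaledLaw_inflow.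
- by rewrite scaledLaw0.
- move=> t t0; rewrite subrK /= mulr0 addr0; apply: sumr_ge0 => u uz.
  have [->|Q0] := eqVneq (Qrate R u z) 0; first by rewrite mulr0.
  have [uS _] := Qrate_neq0 R N u z uz Q0.
  by rewrite mulr_ge0 ?Qrate_ge0// IH.
Qed.

Lemma scaledLaw_eq0 (R : realType) (N : nat) (mu : state N -> R)
    (D : pred (state N)) :
  (forall s, 0 <= mu s) ->
  (forall z, D z -> mu z = 0) ->
  (forall u z, inS z -> u != z -> Qrate R u z != 0 -> D z -> D u) ->
  forall z, inS z -> D z -> forall t : R, 0 <= t -> scaledLaw mu t z = 0.
Proof.
move=> mu0 muD closedD; apply: (inS_predecessor_ind R) => z zS IH Dz t t0.
apply/eqP; rewrite eq_le scaledLaw_ge0// andbT.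
apply: (scaledLaw_le R N mu z (cst 0) (cst 0)) => //.
- by rewrite muD.
- move=> x x0; rewrite /= mulr0 addr0 /inflow big1// => u uz.
  have [->|Q0] := eqVneq (Qrate R u z) 0; first by rewrite mulr0.
  have [uS _] := Qrate_neq0 R N u z uz Q0.
  by rewrite IH ?mul0r//; apply: closedD Q0 Dz.
Qed.

Lemma scaledLaw_growth_le (R : realType) (N m : nat) (mu : state N -> R) :
  (0 < N)%N ->
  (forall s, 0 <= mu s) -> (forall s, (m < sx s)%N -> mu s = 0) ->
  forall z, inS z -> exists2 C : R, 0 <= C & forall t : R, 0 <= t ->
    scaledLaw mu t z <=
      C * (1 + t) `^ (m%:R - (sx z)%:R + (sy z == 1%N)%:R - 2^-1).
Proof.
move=> N0 mu0 mum; apply: (inS_predecessor_ind R) => z zS IH.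
have [mz|zm] := ltnP m (sx z).
  exists 0 => // t t0; rewrite mul0r.
  rewrite (scaledLaw_eq0 R N mu (fun s => m < sx s)%N)//.
  move=> u v _ uv Q0; have [_ h] := Qrate_neq0 R N u v uv Q0; lia.
pose ex (u : state N) : R := m%:R - (sx u)%:R + (sy u == 1%N)%:R - 2^-1.
have /choice[C hC] : forall u : state N, exists C : R, 0 <= C /\
    (u != z -> Qrate R u z != 0 ->
     forall t : R, 0 <= t -> scaledLaw mu t u <= C * (1 + t) `^ ex u).
  move=> u; have [->|uz] := eqVneq u z; first by exists 0.
  have [_|Q0] := eqVneq (Qrate R u z) 0; first by exists 0.
  have [uS _] := Qrate_neq0 R N u z uz Q0.
  by have [C C0 hC] := IH u uS uz Q0; exists C.
pose G : R := \sum_(u : state N | u != z) C u * Qrate R u z.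
have G0 : 0 <= G.
  by apply: sumr_ge0 => u uz; rewrite mulr_ge0 ?Qrate_ge0//; case: (hC u).
have zmR : (sx z)%:R <= m%:R :> R by rewrite ler_nat.
pose e := ex z.
pose C' := 2 * G + mu z.
have C'0 : 0 <= C' by rewrite addr_ge0// mulr_ge0.
have flow (d t : R) : 0 <= t ->
    (forall u, u != z -> Qrate R u z != 0 -> ex u <= d) ->
    inflow mu t z <= G * (1 + t) `^ d.
  move=> t0 hd; rewrite /inflow /G mulr_suml; apply: ler_sum => u uz.
  have [->|Q0] := eqVneq (Qrate R u z) 0; first by rewrite !mulr0 mul0r.
  rewrite [leRHS]mulrAC ler_wpM2r ?Qrate_ge0//.
  have [Cu0 /(_ uz Q0 t t0) h] := hC u; apply: (le_trans h).
  rewrite ler_wpM2l// ler_powR// ?hd//; lra.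
exists C' => // t t0; rewrite -/(ex z) -/e.
have Dw (x : R) : 0 <= x -> is_derive x 1 (fun t : R => C' * (1 + t) `^ e)
    (C' * (e * (1 + x) `^ (e - 1))).
  move=> x0; have x1 : 0 < 1 + x by lra.
  have D1 := is_derive1_powR e x1.
  have D2 : is_derive x 1 (fun x : R => 1 + x) 1.
    by apply: is_derive_eq; rewrite add0r mulr1.
  have D := is_derive1_comp D1 D2.
  by apply: (is_derive_eq (is_deriveZ C' D)); rewrite /GRing.scale /=; ring.
apply: (scaledLaw_le R N mu z _ _ zS Dw) => //.
- by rewrite addr0 powR1 mulr1 /C'; lra.
- move=> x x0; have x1 : 1 <= 1 + x by lra.
  have p0 : 0 <= (1 + x) `^ (e - 1) by exact: powR_ge0.
  case: (eqVneq (sy z) 1%N) => y1.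
    have e2 : 2^-1 <= e by rewrite /e /ex y1 eqxx /=; lra.
    rewrite y1 /= muln0 mul0r addr0.
    apply: (le_trans (flow (e - 1) _ x0 _)).
      move=> u uz Q0; have [_ h] := Qrate_neq0 R N u z uz Q0.
      rewrite /e /ex y1 eqxx /=.
      have [[_ h2]|[-> ->]] := h; last by rewrite y1 /=; lra.
      have [/andP[_ u0] _] := Qrate_neq0 R N u z uz Q0.
      by move: h2 u0; rewrite y1 addn1 => -[<-].
    rewrite mulrA ler_wpM2r//.
    have muz := mu0 z.
    rewrite /C'; nra.
  have e2 : - 2^-1 <= e by rewrite /e /ex (negPf y1) /=; lra.
  have y2 : (1 : R) <= (N * (sy z).-1)%:R.
    have /andP[_ y0] := zS.
    by rewrite ler1n muln_gt0 N0 -subn1 subn_gt0 ltn_neqAle eq_sym y1.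
  apply: (le_trans (flow e _ x0 _)).
    move=> u uz Q0; have [_ h] := Qrate_neq0 R N u z uz Q0.
    rewrite /e /ex (negPf y1) /=.
    have [[-> _]|[-> h2]] := h.
      by rewrite natrD; case: (sy u == 1%N) => /=; lra.
    case: eqP => /= [h3|_]; last lra.
    by have /andP[_] := zS; move: h3; rewrite h2 addn1 => -[->].
  have pp : (1 + x) `^ (e - 1) <= (1 + x) `^ e by rewrite ler_powR//; lra.
  set p := _ `^ (e - 1) in p0 pp *; set q := _ `^ e in pp *.
  have muz := mu0 z.
  have h1 : - (2^-1) * (C' * q) <= C' * (e * p).
    have : 0 <= C' * p by rewrite mulr_ge0.
    have : C' * p <= C' * q by rewrite ler_wpM2l.
    nra.
  have h2 : C' * q <= (N * (sy z).-1)%:R * (C' * q).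
    by rewrite ler_peMl// mulr_ge0// (le_trans p0).
  have h3 : 2 * G * q <= C' * q by rewrite ler_wpM2r ?(le_trans p0)// /C'; lra.
  lra.
Qed.

Lemma sum_Qrate (R : realType) (N : nat) (v : state N) (f : nat -> nat -> R) :
  inSp v ->
  \sum_(z : state N) Qrate R v z * f (sx z) (sy z) =
  - (N * sy v)%:R * f (sx v) (sy v)
  + (sx v * sy v)%:R * f (sx v).-1 (sy v).+1
  + (sy v * (N - sx v))%:R * f (sx v) (sy v).-1.
Proof.
move=> vS; have := vS; rewrite /inSp => xyN.
have xN : (sx v <= N)%N by rewrite -ltnS; exact: (ltn_ord v.1).
pose a : state N := (inord (sx v).-1, inord (sy v).+1).
pose b : state N := (inord (sx v), inord (sy v).-1).
have st_eq (s s' : state N) : (s == s') = (sx s == sx s') && (sy s == sy s').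
  by [].
have ha z : (z == a)%:R * ((sx v * sy v)%:R * f (sx v).-1 (sy v).+1) =
    if (sx z + 1 == sx v)%N && (sy z == sy v + 1)%N
    then (sx v * sy v)%:R * f (sx z) (sy z) else 0.
  have [x0|x0] := posnP (sx v).
    by rewrite x0 mul0n mulr0n !mul0r mulr0; case: ifP.
  have ax : sx a = (sx v).-1 by rewrite /sx /= inordK// -/(sx v); lia.
  have ay : sy a = (sy v).+1 by rewrite /sy /= inordK// -/(sy v); lia.
  rewrite st_eq ax ay.
  have -> : (sx z == (sx v).-1) = (sx z + 1 == sx v)%N by lia.
  rewrite !addn1; case: ifP => [/andP[/eqP <- /eqP ->]|_]; last by rewrite mul0r.
  by rewrite mul1r.
have hb z : (z == b)%:R * ((sy v * (N - sx v))%:R * f (sx v) (sy v).-1) =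
    if (sx z == sx v) && (sy z + 1 == sy v)%N
    then (sy v * (N - sx v))%:R * f (sx z) (sy z) else 0.
  have [y0|y0] := posnP (sy v).
    by rewrite y0 mul0n mulr0n !mul0r mulr0; case: ifP.
  have bx : sx b = sx v by rewrite /sx /= inordK// ltnS.
  have by_ : sy b = (sy v).-1 by rewrite /sy /= inordK// -/(sy v); lia.
  rewrite st_eq bx by_.
  have -> : (sy z == (sy v).-1) = (sy z + 1 == sy v)%N by lia.
  case: ifP => [/andP[/eqP <- /eqP <-]|_]; last by rewrite mul0r.
  by rewrite mul1r addn1.
have hQ z : Qrate R v z * f (sx z) (sy z) =
    (z == v)%:R * (- (N * sy v)%:R * f (sx v) (sy v)) +
    ((z == a)%:R * ((sx v * sy v)%:R * f (sx v).-1 (sy v).+1) +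
     (z == b)%:R * ((sy v * (N - sx v))%:R * f (sx v) (sy v).-1)).
  rewrite ha hb /Qrate vS /= [v == z]eq_sym.
  have [->|zv] := eqVneq z v.
    rewrite mul1r !ifF ?addr0//; lia.
  rewrite mul0r add0r; case: ifP => [/andP[/eqP h1 /eqP h2]|_].
    by rewrite ifF ?addr0//; lia.
  by rewrite add0r; case: ifP => // _; rewrite mul0r.
rewrite (eq_bigr _ (fun z _ => hQ z)) !big_split /= -!mulr_suml.
have one (s : state N) : \sum_(z : state N) (z == s)%:R = 1 :> R.
  by rewrite (bigD1 s)//= eqxx big1 ?addr0// => i /negPf ->.
by rewrite !one !mul1r addrA.
Qed.

(* On the row [x = x0] the rescaled generator annihilates [y r^(y-1)] with
   [r = (N - x0) / N], so the weighted row mass changes only through the inflow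
   from the row [x0 + 1]. *)
Definition rowWeight (R : realType) (N x0 a b : nat) : R :=
  if (a + b <= N.+1)%N && (a == x0)
  then b%:R * ((N - x0)%:R / N%:R) ^+ b.-1 else 0.

Definition rowMass {R : realType} {N : nat} (mu : state N -> R) (x0 : nat) (t : R) : R :=
  \sum_(z : state N) rowWeight R N x0 (sx z) (sy z) * scaledLaw mu t z.

Lemma rowWeight_ge0 (R : realType) (N x0 a b : nat) : 0 <= rowWeight R N x0 a b.
Proof.
by rewrite /rowWeight; case: ifP => // _; rewrite mulr_ge0// exprn_ge0// divr_ge0.
Qed.

Lemma rowWeight_notin (R : realType) (N x0 : nat) (v : state N) :
  ~~ inS v -> rowWeight R N x0 (sx v) (sy v) = 0.
Proof.
rewrite /inS /rowWeight /inSp; case: (sx v + sy v <= N.+1)%N => //=.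
by rewrite -eqn0Ngt => /eqP ->; rewrite mul0r; case: ifP.
Qed.

Lemma generator_rowWeight (R : realType) (N x0 : nat) (v : state N) : (0 < N)%N ->
  N%:R * rowWeight R N x0 (sx v) (sy v) +
    \sum_(z : state N) Qrate R v z * rowWeight R N x0 (sx z) (sy z) =
  if inS v && (sx v == x0.+1)
  then (x0.+1 * sy v)%:R * ((sy v).+1%:R * ((N - x0)%:R / N%:R) ^+ (sy v))
  else 0.
Proof.
move=> N0; have NR : N%:R != 0 :> R by rewrite pnatr_eq0 -lt0n.
have [vS|vS] := boolP (inSp v); last first.
  have vnS : ~~ inS v by rewrite /inS (negPf vS).
  rewrite (negPf vnS) rowWeight_notin// mulr0 add0r big1// => z _.
  by rewrite /Qrate vS mul0r.
rewrite sum_Qrate//.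
have := vS; rewrite /inSp => xyN.
have xN : (sx v <= N)%N by rewrite -ltnS; exact: (ltn_ord v.1).
rewrite /inS vS /= /rowWeight xyN /=.
set x := sx v in xyN xN *; set y := sy v in xyN *.
have -> : (x + y.-1 <= N.+1)%N by lia.
have [y0|y0] := posnP y.
  by rewrite y0 /= !muln0 mul0n mulr0n !mul0r; case: ifP; rewrite ?mulr0 ?oppr0 ?mul0r ?addr0.
have [xx0|xx0] /= := eqVneq x x0.
  rewrite -xx0 (ltn_eqF (ltnSn x)) ?andbF.
  have -> : (x * y)%:R * (if (x.-1 + y.+1 <= N.+1)%N && (x.-1 == x) then
      y.+1%:R * ((N - x)%:R / N%:R) ^+ y.+1.-1 else 0) = 0 :> R.
    case: x {xx0 xyN xN} => [|x]; first by rewrite mul0n mulr0n mul0r.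
    by rewrite /= ltn_eqF// andbF mulr0.
  rewrite addr0; case: y y0 xyN => // -[|y] _ _ /=.
    by rewrite muln1 mul0r mulr0 addr0; ring.
  rewrite exprS !natrM.
  set r := (_ / _).
  have rN : (N - x)%:R = N%:R * r :> R by rewrite /r mulrCA divff ?mulr1.
  by rewrite rN -natr1; ring.
rewrite !mulr0 addr0 !add0r.
case: (eqVneq x x0.+1) => [xE|xSx0] /=.
  rewrite xE in xyN *.
  by rewrite eqxx andbT ifT//; lia.
case: ifP => [/andP[_ /eqP h]|_]; last by rewrite mulr0.
have -> : x = 0%N by lia.
by rewrite mul0n mulr0n mul0r.
Qed.

Lemma generator_rowWeight_ge (R : realType) (N x0 : nat) (v : state N) : (x0 < N)%N ->
  N%:R^-1 * rowWeight R N x0.+1 (sx v) (sy v) <=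
  N%:R * rowWeight R N x0 (sx v) (sy v) +
    \sum_(z : state N) Qrate R v z * rowWeight R N x0 (sx z) (sy z).
Proof.
move=> xN; have N0 : (0 < N)%N by exact: leq_ltn_trans xN.
rewrite generator_rowWeight//.
have [vS|vS] /= := boolP (inS v); last by rewrite rowWeight_notin// mulr0.
rewrite /rowWeight; have /andP[h y0] := vS; move: h; rewrite /inSp => ->.
case: (eqVneq (sx v) x0.+1) => [_|_] /=; last by rewrite mulr0.
have NR : 0 < N%:R :> R by rewrite ltr0n.
case: (sy v) y0 => // y _ /=.
set r := (N - x0)%:R / N%:R; set r' := (N - x0.+1)%:R / N%:R.
have r'0 : 0 <= r' :> R by rewrite divr_ge0.
have r'r : r' <= r :> R by rewrite ler_wpM2r ?invr_ge0// ler_nat; lia.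
have rN : N%:R^-1 <= r :> R.
  rewrite -[leLHS]mul1r ler_wpM2r ?invr_ge0// ler1n; lia.
have p1 : r' ^+ y <= r ^+ y by apply: lerXn2r; rewrite ?nnegrE// (le_trans r'0).
have p0 : 0 <= r' ^+ y by rewrite exprn_ge0.
apply: (@le_trans _ _ (r * (y.+1%:R * r ^+ y))).
  apply: ler_pM => //; first by rewrite mulr_ge0.
  by rewrite ler_wpM2l.
rewrite exprS natrM.
have q0 : 0 <= y.+1%:R * (r * r ^+ y).
  by rewrite !mulr_ge0// ?exprn_ge0// (le_trans r'0 r'r).
rewrite (_ : r * (y.+1%:R * r ^+ y) = y.+1%:R * (r * r ^+ y)); last by ring.
rewrite (_ : x0.+1%:R * y.+1%:R * (y.+2%:R * (r * r ^+ y)) =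
  (x0.+1 * y.+2)%:R * (y.+1%:R * (r * r ^+ y))); last by rewrite natrM; ring.
by rewrite ler_peMl// ler1n muln_gt0.
Qed.

Lemma is_derive_rowMass (R : realType) (N x0 : nat) (mu : state N -> R) (t : R) :
  is_derive t 1 (rowMass mu x0)
    (\sum_(v : state N) scaledLaw mu t v *
       (N%:R * rowWeight R N x0 (sx v) (sy v) +
        \sum_(z : state N) Qrate R v z * rowWeight R N x0 (sx z) (sy z))).
Proof.
have -> : \sum_(v : state N) scaledLaw mu t v *
       (N%:R * rowWeight R N x0 (sx v) (sy v) +
        \sum_(z : state N) Qrate R v z * rowWeight R N x0 (sx z) (sy z)) =
    \sum_(z : state N) rowWeight R N x0 (sx z) (sy z) *
      (N%:R * scaledLaw mu t z + \sum_(u : state N) scaledLaw mu t u * Qrate R u z).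
  under eq_bigr do rewrite mulrDr.
  under [RHS]eq_bigr do rewrite mulrDr.
  rewrite !big_split /=; congr (_ + _); first by apply: eq_bigr => z _; ring.
  under eq_bigr do rewrite mulr_sumr.
  rewrite exchange_big /=; apply: eq_bigr => z _; rewrite mulr_sumr.
  by apply: eq_bigr => u _; ring.
apply: is_derive_sum_fin => z.
exact: (is_deriveZ _ (is_derive_scaledLaw R N mu z t)).
Qed.

Lemma rowMass_growth_ge (R : realType) (N : nat) (mu : state N -> R) (s0 : state N) :
  (0 < N)%N -> (forall s, 0 <= mu s) -> inS s0 -> 0 < mu s0 ->
  forall j, (j <= sx s0)%N -> exists2 c : R, 0 < c &
    forall t : R, 0 <= t -> c * t ^+ j <= rowMass mu (sx s0 - j) t.
Proof.
move=> N0 mu0 s0S mus0.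
have xN : (sx s0 <= N)%N by rewrite -ltnS; exact: (ltn_ord s0.1).
have lawS (t : R) v : 0 <= t -> ~~ inS v \/ 0 <= scaledLaw mu t v.
  by move=> t0; case: (boolP (inS v)) => vS; [right; exact: scaledLaw_ge0|left].
elim=> [_|j IH jm].
  pose c := rowMass mu (sx s0) (0 : R); exists c.
    rewrite /c /rowMass (bigD1 s0)//= scaledLaw0 ltr_pwDl//; last first.
      by apply: sumr_ge0 => z _; rewrite mulr_ge0 ?rowWeight_ge0// scaledLaw0.
    rewrite mulr_gt0// /rowWeight; have /andP[h y0] := s0S.
    move: (h); rewrite /inSp eqxx => -> /=.
    rewrite mulr_gt0 ?ltr0n//.
    have [xN'|xN'] := ltnP (sx s0) N.
      by rewrite exprn_gt0// divr_gt0// ltr0n// subn_gt0.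
    have -> : sy s0 = 1%N by move: h; rewrite /inSp; lia.
    by rewrite expr0.
  move=> t t0; rewrite expr0 mulr1 subn0.
  apply: (ODE_comparison 0 (cst c) _ (cst 0) _ _
    (fun t _ => is_derive_rowMass R N (sx s0) mu t)) => // x x0.
  rewrite !mul0r !addr0; apply: sumr_ge0 => v _.
  rewrite generator_rowWeight//; case: (lawS x v x0) => [/negPf ->|h] /=.
    by rewrite mulr0.
  apply: mulr_ge0 => //; case: ifP => // _.
have [c c0 hc] := IH (ltnW jm).
set x0 := (sx s0 - j.+1)%N.
have x0E : (sx s0 - j)%N = x0.+1 by rewrite /x0; lia.
have x0N : (x0 < N)%N by rewrite /x0; lia.
exists (c / N%:R / j.+1%:R); first by rewrite !divr_gt0 ?ltr0n.
have D (t : R) : is_derive t 1 (fun x : R => c / N%:R / j.+1%:R * x ^+ j.+1)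
    (c / N%:R * t ^+ j).
  have -> : (fun x : R => c / N%:R / j.+1%:R * x ^+ j.+1) =
      c / N%:R / j.+1%:R \*: ((@id R) ^+ j.+1).
    by apply/funext => x; rewrite exprfctE.
  apply: is_derive_eq; rewrite /GRing.scale /= mulr1 mulrA.
  by rewrite divfK// pnatr_eq0.
apply: (ODE_comparison 0 _ _ _ _ (fun t _ => D t)
    (fun t _ => is_derive_rowMass R N x0 mu t)).
- rewrite expr0n mulr0; apply: sumr_ge0 => z _.
  by rewrite mulr_ge0 ?rowWeight_ge0// scaledLaw0.
move=> t t0; rewrite !mul0r !addr0.
apply: (@le_trans _ _ (N%:R^-1 * rowMass mu x0.+1 t)).
  by rewrite -x0E mulrAC mulrC ler_wpM2l ?invr_ge0// hc.
rewrite /rowMass mulr_sumr; apply: ler_sum => v _.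
case: (lawS t v t0) => [vS|h].
  by rewrite rowWeight_notin// generator_rowWeight// (negPf vS) /= mul0r !mulr0.
by rewrite mulrA [leRHS]mulrC ler_wpM2r// generator_rowWeight_ge.
Qed.

Lemma survival_growth_ge (R : realType) (N : nat) (mu : state N -> R) (s0 : state N) :
  (0 < N)%N -> (forall s, 0 <= mu s) -> inS s0 -> 0 < mu s0 ->
  exists2 c : R, 0 < c &
    forall t : R, 0 <= t -> c * t ^+ (sx s0) <= \sum_(z | inS z) scaledLaw mu t z.
Proof.
move=> N0 mu0 s0S mus0.
have [c c0 hc] := rowMass_growth_ge R N mu s0 N0 mu0 s0S mus0 (sx s0) (leqnn _).
exists (c / N.+1%:R); first by rewrite divr_gt0.
move=> t t0; rewrite mulrAC ler_pdivrMr ?ltr0n//.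
apply: (le_trans (hc t t0)); rewrite subnn /rowMass mulr_suml.
rewrite [leRHS]big_mkcond /=; apply: ler_sum => z _.
case: ifPn => zS; last by rewrite rowWeight_notin// mul0r.
rewrite mulrC ler_wpM2l ?scaledLaw_ge0// /rowWeight.
case: ifP => // _; rewrite subn0 divff ?pnatr_eq0 -?lt0n//.
by rewrite expr1n mulr1 ler_nat -ltnS; exact: (ltn_ord z.2).
Qed.

Lemma condLaw_scaled (R : realType) (N : nat) (mu : state N -> R) (t : R)
    (A : {set state N}) :
  condLaw mu t A =
    (\sum_(z in A) scaledLaw mu t z) / \sum_(z | inS z) scaledLaw mu t z.
Proof.
rewrite /condLaw /survProb /scaledLaw -!mulr_sumr invfM mulrACA divff ?mul1r//.
by rewrite gt_eqF// expR_gt0.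
Qed.

Lemma sx_st01 (N : nat) : sx (st01 N) = 0%N. Proof. by []. Qed.

Lemma sy_st01 (N : nat) : sy (st01 N) = 1%N.
Proof. by rewrite /sy /= inordK. Qed.

Lemma inS_st01 (N : nat) : inS (st01 N).
Proof. by rewrite /inS /inSp sx_st01 sy_st01. Qed.

Lemma st01P (N : nat) (z : state N) : (z == st01 N) = (sx z == 0%N) && (sy z == 1%N).
Proof. by rewrite -(sy_st01 N). Qed.

Lemma probOnS_top (R : realType) (N : nat) (mu : state N -> R) : probOnS mu ->
  exists s0, [/\ inS s0, 0 < mu s0 & forall s, (sx s0 < sx s)%N -> mu s = 0].
Proof.
move=> [mu0 [muS mu1]].
have [s1 s1P] : exists s, 0 < mu s.
  apply: contrapT => /forallNP h; have /eqP := mu1.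
  rewrite big1 ?(eq_sym 0) ?oner_eq0// => s _; apply/eqP.
  by rewrite eq_le mu0 andbT leNgt; apply/negP/h.
have [s0 s0P s0max] := @arg_maxnP _ s1 (fun s => 0 < mu s) (@sx N) s1P.
exists s0; split=> //.
  by apply/negPn/negP => /muS h; move: s0P; rewrite h ltxx.
move=> s; rewrite ltnNge => /negP h; apply/eqP.
by rewrite eq_le mu0 andbT leNgt; apply/negP => /s0max.
Qed.

Lemma cvg_scaled_invsqrt (R : realType) (K : R) :
  (fun t : R => K * (1 + t) `^ (- 2^-1)) @ +oo%R --> (0 : R).
Proof.
rewrite -[X in _ --> X](mulr0 K); apply: cvgMl_tmp.
apply/cvgrPdist_le => e e0; near=> t.
have t0 : (e^-1) ^+ 2 <= 1 + t.
  near: t; apply: filterS (nbhs_pinfty_ge (num_real ((e^-1) ^+ 2))).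
  by move=> t; lra.
have t1 : 0 <= 1 + t by rewrite (le_trans _ t0)// sqr_ge0.
rewrite sub0r normrN ger0_norm ?powR_ge0// powRN powR12_sqrt//.
rewrite -[leRHS]invrK lef_pV2 ?posrE ?invr_gt0//; last first.
  rewrite sqrtr_gt0 (lt_le_trans _ t0)// exprn_gt0// invr_gt0//.
rewrite -[leLHS]ger0_norm ?invr_ge0 ?(ltW e0)// -sqrtr_sqr.
exact: ler_wsqrtr.
Unshelve. all: by end_near. Qed.

Lemma condLaw_cvg0 (R : realType) (N : nat) (mu : state N -> R) (z : state N) :
  (0 < N)%N -> probOnS mu -> inS z -> z != st01 N ->
  (fun t : R => condLaw mu t [set z]) @ +oo%R --> (0 : R).
Proof.
move=> N0 pmu zS z01; have [mu0 _] := pmu.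
have [s0 [s0S mus0 s0max]] := probOnS_top R N mu pmu.
have [C C0 hC] := scaledLaw_growth_le R N (sx s0) mu N0 mu0 s0max z zS.
have [c c0 hc] := survival_growth_ge R N mu s0 N0 mu0 s0S mus0.
set m := sx s0 in hC hc.
pose e : R := m%:R - (sx z)%:R + (sy z == 1%N)%:R - 2^-1.
have em : e <= m%:R - 2^-1.
  rewrite /e; move: z01; rewrite st01P negb_and.
  case: (sx z) => [|x] /=; first by move=> /negPf ->; rewrite /=; lra.
  have : 0 <= x%:R :> R by [].
  by rewrite -natr1; case: (sy z == 1%N) => /=; lra.
pose K := C * 2 ^+ m / c.
apply: (@squeeze_cvgr _ _ _ _ (cst 0) (fun t : R => K * (1 + t) `^ (- 2^-1))).
- near=> t.
  have t1 : 1 <= t by near: t; exact: nbhs_pinfty_ge.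
  have t0 : 0 <= t by lra.
  rewrite condLaw_scaled big_set1 /=; apply/andP; split.
    rewrite divr_ge0 ?scaledLaw_ge0//.
    by apply: sumr_ge0 => u uS; exact: scaledLaw_ge0.
  have tm : 0 < t ^+ m by rewrite exprn_gt0//; lra.
  have q0 : 0 <= (1 + t) `^ (- 2^-1) by exact: powR_ge0.
  rewrite ler_pdivrMr; last by apply: lt_le_trans (hc t t0); rewrite mulr_gt0.
  apply: (@le_trans _ _ (K * (1 + t) `^ (- 2^-1) * (c * t ^+ m))); last first.
    by rewrite ler_wpM2l ?hc// /K !mulr_ge0 ?invr_ge0 ?exprn_ge0 ?(ltW c0).
  apply: (le_trans (hC t t0)); rewrite -/e.
  have -> : K * (1 + t) `^ (- 2^-1) * (c * t ^+ m) =
      C * ((2 * t) ^+ m * (1 + t) `^ (- 2^-1)).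
    by rewrite /K exprMn; field; rewrite gt_eqF.
  rewrite ler_wpM2l//.
  apply: (@le_trans _ _ ((1 + t) `^ (m%:R - 2^-1))).
    by rewrite ler_powR//; lra.
  rewrite powRD ?powR_mulrn; last 2 first.
  - by lra.
  - by apply/implyP => _; rewrite gt_eqF//; lra.
  by rewrite ler_wpM2r// lerXn2r ?nnegrE//; lra.
- exact: cvg_cst.
- exact: cvg_scaled_invsqrt.
Unshelve. all: by end_near. Qed.

Lemma condLaw_cvg (R : realType) (N : nat) (mu : state N -> R) (z : state N) :
  (0 < N)%N -> probOnS mu -> inS z ->
  (fun t : R => condLaw mu t [set z]) @ +oo%R --> delta01 R z.
Proof.
move=> N0 pmu zS; rewrite /delta01.
have [->|z01] := eqVneq z (st01 N); last exact: condLaw_cvg0.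
have [s0 [s0S mus0 s0max]] := probOnS_top R N mu pmu; have [mu0 _] := pmu.
have [c c0 hc] := survival_growth_ge R N mu s0 N0 mu0 s0S mus0.
have cv : (fun t : R => 1 - \sum_(u | inS u && (u != st01 N)) condLaw mu t [set u])
    @ +oo%R --> (1 - \sum_(u : state N | inS u && (u != st01 N)) 0 : R).
  apply: cvgB; first exact: cvg_cst.
  apply: cvg_big => [|u /andP[uS u01]]; first exact: add_continuous.
  exact: condLaw_cvg0.
rewrite big1 ?subr0 // in cv.
apply: cvg_trans cv; apply: near_eq_cvg; near=> t.
have t1 : 1 <= t by near: t; exact: nbhs_pinfty_ge.
have t0 : 0 <= t by lra.
have U0 : \sum_(u | inS u) scaledLaw mu t u != 0.
  by rewrite gt_eqF//; apply: lt_le_trans (hc t t0); rewrite mulr_gt0// exprn_gt0//; lra.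
under eq_bigr do rewrite condLaw_scaled big_set1.
rewrite condLaw_scaled big_set1 -mulr_suml; apply/eqP; rewrite subr_eq -mulrDl.
rewrite -(bigD1 (st01 N) (inS_st01 N)) /= divff//.
Unshelve. all: by end_near. Qed.

Lemma delta01_isQSD (R : realType) (N : nat) : (0 < N)%N ->
  isQSD (delta01 R (N := N)).
Proof.
move=> N0; pose nu : state N -> R := delta01 R (N := N).
have nu0 s : 0 <= nu s by rewrite /nu /delta01.
have pnu : probOnS nu.
  split=> //; split.
    move=> s sS; rewrite /nu /delta01; case: eqP => // sE.
    by move: sS; rewrite sE inS_st01.
  rewrite (bigD1 (st01 N))//= /nu /delta01 eqxx big1 ?addr0// => s.
  by move=> /negPf ->.
split=> // t t0 A AS.
have [c c0 hc] : exists2 c : R, 0 < c & forall t : R, 0 <= t ->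
    c * t ^+ (sx (st01 N)) <= \sum_(z | inS z) scaledLaw nu t z.
  by apply: survival_growth_ge => //; rewrite ?inS_st01// /nu /delta01 eqxx.
have z0 z : inS z -> z != st01 N -> scaledLaw nu t z = 0.
  move=> zS z01; apply: (scaledLaw_eq0 R N nu (fun s => s != st01 N)) => //.
    by move=> s /negPf; rewrite /nu /delta01 => ->.
  move=> u v /andP[_ v0] uv Q0 _; have [_ h] := Qrate_neq0 R N u v uv Q0.
  rewrite st01P; have [[-> _]|[_ ->]] := h; first by rewrite addn1.
  by rewrite addn1 eqSS (gtn_eqF v0) andbF.
have U01 : \sum_(z | inS z) scaledLaw nu t z = scaledLaw nu t (st01 N).
  rewrite (bigD1 (st01 N)) ?inS_st01//= big1 ?addr0// => z /andP[zS z01].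
  exact: z0.
have UA : \sum_(z in A) scaledLaw nu t z =
    (\sum_(z in A) nu z) * scaledLaw nu t (st01 N).
  rewrite mulr_suml; apply: eq_bigr => z zA.
  have zS : inS z by have := fintype.subsetP AS z zA; rewrite inE.
  rewrite /nu /delta01; have [->|z01] := eqVneq z (st01 N); first by rewrite mul1r.
  by rewrite mul0r -/nu z0.
rewrite condLaw_scaled -/nu UA U01 mulfK//.
rewrite -U01 gt_eqF//; apply: lt_le_trans (hc t t0).
by rewrite sx_st01 expr0 mulr1.
Qed.

Theorem mainTheorem1 (R : realType) (N : nat) (hN : (1 <= N)%N) :
  (forall nu : state N -> R, isQSD nu <-> nu = delta01 R (N:=N)) /\
  (forall mu : state N -> R, probOnS mu ->
     forall z : state N, inS z ->
       (fun t : R => condLaw mu t [set z]) @ +oo%R --> delta01 R z).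
Proof.
split; last by move=> mu pmu z zS; exact: condLaw_cvg.
move=> nu; split=> [[pnu qsd]|->]; last exact: delta01_isQSD.
apply/funext => z; have [zS|zS] := boolP (inS z); last first.
  have [_ [-> //]] := pnu; rewrite /delta01; case: eqP => // zE.
  by move: zS; rewrite zE inS_st01.
have nuz : (fun t : R => condLaw nu t [set z]) @ +oo%R --> nu z.
  apply: (@cvg_trans _ ((fun=> nu z) @ +oo%R)); last exact: cvg_cst.
  apply: near_eq_cvg; near=> t.
  have t0 : 0 <= t by near: t; exact: nbhs_pinfty_ge.
  by rewrite qsd// ?big_set1//; apply/fintype.subsetP => s; rewrite !inE => /eqP ->.
have := condLaw_cvg R N nu z hN pnu zS.
exact: cvg_unique nuz.
Unshelve. all: by end_near. Qed.
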